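(* Let $n\ge 3$ and let $F_n=\{(2i-1,2i) : 1\le i\le\lfloor n/2\rfloor\}$. Let $R$ be a set of two-layer comparator networks on $n$ channels with first layer $F_n$ containing exactly one representative of each $\approx$-equivalence class of two-layer comparator networks on $n$ channels whose first layer is $F_n$. Then $R$ is a complete set of filters for the optimal-depth sorting network problem on $n$ channels.
   Context: A comparator network on $n$ channels of depth $d$ is a sequence $C=L_1;\ldots;L_d$ of layers; each layer is a set of comparators $(i,j)$, $1\le i<j\le n$, with each channel in at most one comparator of the layer. On an input, comparator $(i,j)$ puts the minimum of the values on channels $i,j$ on channel $i$ and the maximum on channel $j$; untouched channels keep their values. A sorting network sorts every input ascendingly. For networks $C_1,C_2$, $C_1;C_2$ is the concatenation of their layers. Graph representation: $\mathcal G(C)$ has one vertex per comparator of $C$; for a comparator $u$ in layer $k$ and a comparator $v$ in a later layer, there is an edge labeled $1$ (resp. $2$) from $u$ to $v$ if the channel on which $u$ outputs its minimum (resp. maximum) is an input channel of $v$ and no comparator in a layer strictly between those of $u$ and $v$ uses that channel. Write $C_1\approx C_2$ if $\mathcal G(C_1)$ and $\mathcal G(C_2)$ are isomorphic as edge-labeled directed graphs. A set $\mathcal F$ of comparator networks on $n$ channels is a complete set of filters for the optimal-depth sorting network problem if there exists a sorting network on $n$ channels of minimum possible depth of the form $C;C'$ for some $C\in\mathcal F$. *)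

(* Defs.v *)
From mathcomp Require Import all_boot all_order.

Set Implicit Arguments.
Unset Strict Implicit.
Unset Printing Implicit Defensive.

(* Channels are numbered from 0: channel i of the usual 1-based numbering is
   the ordinal i - 1.  The type [network n] also contains ill-formed objects;
   [comparator_network] singles out the genuine comparator networks. *)
Definition comparator (n : nat) : Type := ('I_n * 'I_n)%type.
Definition layer (n : nat) : Type := {set 'I_n * 'I_n}.
Definition network (n : nat) : Type := seq (layer n).

Definition uses (n : nat) (c : comparator n) (i : 'I_n) : bool :=
  (i == c.1) || (i == c.2).

Definition is_layer (n : nat) (L : layer n) : bool :=
  [forall c in L, c.1 < c.2] && [forall i, #|[set c in L | uses c i]| <= 1].

Definition comparator_network (n : nat) (C : network n) : bool :=
  all (@is_layer n) C.

Definition depth (n : nat) (C : network n) : nat := size C.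

(* In a well-formed layer the comparator using channel i, if any, is unique,
   so the choice made by [pick] is immaterial. *)
Definition apply_layer (n : nat) (d : Order.disp_t) (T : orderType d)
    (x : 'I_n -> T) (L : layer n) : 'I_n -> T :=
  fun i =>
    if [pick c in L | uses c i] is Some c then
      if i == c.1 then Order.min (x c.1) (x c.2) else Order.max (x c.1) (x c.2)
    else x i.

Definition run (n : nat) (d : Order.disp_t) (T : orderType d)
    (C : network n) (x : 'I_n -> T) : 'I_n -> T :=
  foldl (@apply_layer n d T) x C.

Definition sorting_network (n : nat) (C : network n) : Prop :=
  comparator_network C /\
  forall (d : Order.disp_t) (T : orderType d) (x : 'I_n -> T) (i j : 'I_n),
    i <= j -> (run C x i <= run C x j)%O.

Definition optimal_depth_sorting_network (n : nat) (C : network n) : Prop :=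
  sorting_network C /\
  forall C' : network n, sorting_network C' -> depth C <= depth C'.

Definition layer_at (n : nat) (C : network n) (k : nat) : layer n :=
  nth set0 C k.

(* A vertex is a comparator together with the index of its layer: the same
   pair of channels occurring in two layers gives two vertices. *)
Definition vertex (n : nat) (C : network n) : Type :=
  {u : 'I_(size C) * ('I_n * 'I_n) | u.2 \in layer_at C u.1}.

Inductive label : Type := Label1 | Label2.

Definition out_channel (n : nat) (l : label) (c : comparator n) : 'I_n :=
  match l with Label1 => c.1 | Label2 => c.2 end.

(* There may be an edge of each label from u to v. *)
Definition edge (n : nat) (C : network n) (l : label) (u v : vertex C) : Prop :=
  let: (k, c) := val u in
  let: (k', c') := val v in
  [/\ k < k',
      uses c' (out_channel l c)
    & forall m : nat, k < m < k' ->
      forall e : comparator n, e \in layer_at C m ->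
        ~~ uses e (out_channel l c)].

Definition graph_equiv (n : nat) (C1 C2 : network n) : Prop :=
  exists f : vertex C1 -> vertex C2,
    bijective f /\
    forall (l : label) (u v : vertex C1), edge l u v <-> edge l (f u) (f v).

Definition first_layer (n : nat) : layer n :=
  [set c : 'I_n * 'I_n |
    [exists i : 'I_(n./2), (c.1 == i.*2 :> nat) && (c.2 == i.*2.+1 :> nat)]].

Definition two_layer_network_from (n : nat) (L : layer n) (C : network n)
    : Prop :=
  [/\ comparator_network C, depth C = 2 & layer_at C 0 = L].

Definition complete_set_of_filters (n : nat) (F : network n -> Prop) : Prop :=
  exists C C' : network n, F C /\ optimal_depth_sorting_network (C ++ C').

(* Main.v *)
(** Relabelling the channels of a network by a permutation [p] and then reversing
    every comparator that has become upside down yields a network [untangle p C]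
    such that [run (untangle p C) x \o run C p = run C (x \o p)]: the permutation
    accumulated while untangling is the result of running [C] on [p] itself. If
    [C] sorts, [run C p] is the identity, so [untangle p C] sorts too.

    Start from an optimal sorting network. Relabel it so that its first layer is
    contained in F_n, and enlarge the latter to F_n, since comparing twice is
    harmless. The prefix is now equivalent to a member of [R]. A graph isomorphism
    between two such prefixes preserves the layers, as the second-layer vertices
    are those with an incoming edge; its action on the first layer induces a
    permutation of the channels, and untangling along it turns one prefix into
    the other. *)
Require Import Defs.
From mathcomp Require Import all_boot all_order.
From mathcomp Require Import zify.
From Stdlib Require Import Classical.

Set Implicit Arguments.
Unset Strict Implicit.
Unset Printing Implicit Defensive.

Import Order.TTheory.

(** * Layers and their action on inputs *)

Lemma is_layerP n (L : layer n) :
  reflect ((forall c, c \in L -> c.1 < c.2) /\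
           (forall c c' i, c \in L -> c' \in L -> uses c i -> uses c' i ->
              c = c'))
          (is_layer L).
Proof.
apply: (iffP andP) => -[H1 H2]; split.
- by move=> c cL; apply: (implyP (forallP H1 c)).
- move=> c c' i cL c'L ci c'i.
  by move/card_le1_eqP: (forallP H2 i); apply; rewrite !inE ?cL ?c'L.
- by apply/forallP => c; apply/implyP; apply: H1.
- apply/forallP => i; apply/card_le1_eqP => c c'.
  rewrite !inE => /andP[cL ci] /andP[c'L c'i].
  exact: (H2 _ _ i).
Qed.

Lemma uses1 n (c : comparator n) : uses c c.1.
Proof. by rewrite /uses eqxx. Qed.

Lemma uses2 n (c : comparator n) : uses c c.2.
Proof. by rewrite /uses eqxx orbT. Qed.

Lemma channelP n (L : layer n) (i : 'I_n) :
  (exists2 c, c \in L & i = c.1 \/ i = c.2) \/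
  (forall c, c \in L -> ~~ uses c i).
Proof.
case: (boolP [exists c in L, uses c i]) => [/existsP[c /andP[cL ci]]|].
  by left; exists c => //; case/orP: ci => /eqP ->; [left|right].
rewrite negb_exists => /forallP H; right=> c cL.
by have := H c; rewrite cL.
Qed.

Section ApplyLayer.
Variables (n : nat) (L : layer n) (d : Order.disp_t) (T : orderType d).
Implicit Type x : 'I_n -> T.

Lemma apply_layer_unused x i :
  (forall c, c \in L -> ~~ uses c i) -> apply_layer x L i = x i.
Proof.
by rewrite /apply_layer => H; case: pickP => // c /andP[/H/negbTE ->].
Qed.

Hypothesis HL : is_layer L.

Lemma apply_layer1 x c :
  c \in L -> apply_layer x L c.1 = Order.min (x c.1) (x c.2).
Proof.
have [_ H2] := is_layerP _ HL.
move=> cL; rewrite /apply_layer; case: pickP => [c' /andP[c'L c'i]|/(_ c)].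
  by rewrite -(H2 c c' c.1) ?uses1 // eqxx.
by rewrite cL uses1.
Qed.

Lemma apply_layer2 x c :
  c \in L -> apply_layer x L c.2 = Order.max (x c.1) (x c.2).
Proof.
have [H1 H2] := is_layerP _ HL.
move=> cL; rewrite /apply_layer; case: pickP => [c' /andP[c'L c'i]|/(_ c)].
  rewrite -(H2 c c' c.2) ?uses2 //; case: eqP => // E.
  by have := H1 _ cL; rewrite E ltnn.
by rewrite cL uses2.
Qed.

(** A comparator only permutes its two input values, so no value is lost. On channel permutations
    this surjectivity yields injectivity, by finiteness. *)
Lemma apply_layer_onto x k : exists p, apply_layer x L p = x k.
Proof.
case: (channelP L k) => [[c cL E]|H]; last first.
  by exists k; apply: apply_layer_unused.
have [le|lt] := leP (x c.1) (x c.2); case: E => ->.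
- by exists c.1; rewrite apply_layer1 // min_l.
- by exists c.2; rewrite apply_layer2 // max_r.
- by exists c.2; rewrite apply_layer2 // max_l // ltW.
- by exists c.1; rewrite apply_layer1 // min_r // ltW.
Qed.

End ApplyLayer.

Lemma run_onto n d (T : orderType d) (C : network n) (x : 'I_n -> T) k :
  comparator_network C -> exists p, run C x p = x k.
Proof.
elim: C x k => [|L C IH] x k /=; first by exists k.
case/andP=> HL HC; have [p <-] := apply_layer_onto HL x k.
exact: IH.
Qed.

Lemma onto_inj (T : finType) (f : T -> T) :
  (forall k, exists p, f p = k) -> injective f.
Proof. by case/fin_all_exists => g /canF_sym /can_inj. Qed.

(** * Relabelling and untangling networks *)

Definition relabel_layer n (p : 'I_n -> 'I_n) (L : layer n) : layer n :=
  [set (Order.min (p c.1) (p c.2), Order.max (p c.1) (p c.2)) | c in L].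

Lemma relabel_layer_uses n (p : 'I_n -> 'I_n) (c : comparator n) i :
  uses (Order.min (p c.1) (p c.2), Order.max (p c.1) (p c.2)) i =
  (i == p c.1) || (i == p c.2).
Proof. by rewrite /uses /=; case: leP => // _; rewrite orbC. Qed.

Lemma relabel_layer_unused n (p : 'I_n -> 'I_n) (L : layer n) i :
  injective p -> (forall c, c \in L -> ~~ uses c i) ->
  forall c, c \in relabel_layer p L -> ~~ uses c (p i).
Proof.
move=> pI H _ /imsetP[c cL ->]; rewrite relabel_layer_uses !(inj_eq pI).
exact: H.
Qed.

Lemma is_layer_relabel n (p : 'I_n -> 'I_n) (L : layer n) :
  injective p -> is_layer L -> is_layer (relabel_layer p L).
Proof.
move=> pI HL; have [H1 H2] := is_layerP _ HL; apply/is_layerP; split.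
  move=> _ /imsetP[c cL ->] /=.
  have: p c.1 != p c.2 by rewrite (inj_eq pI) neq_ltn H1.
  by case: ltgtP.
move=> _ _ i /imsetP[c cL ->] /imsetP[c' c'L ->]; rewrite !relabel_layer_uses.
move=> ci c'i; suff -> : c = c' by [].
case/orP: ci c'i => /eqP-> /orP[] /eqP /pI E;
  by [apply: (H2 c c' c.1); rewrite // /uses E eqxx ?orbT
     |apply: (H2 c c' c.2); rewrite // /uses E eqxx ?orbT].
Qed.

(** A comparator reversed by [p] gets its ends swapped, and running the layer on [p] itself, with
    values in the ordered type ['I_n], performs exactly this swap. So [apply_layer p L] tells where
    each output of [L] now appears. *)
Lemma apply_relabel_layer n (p : 'I_n -> 'I_n) (L : layer n)
    d (T : orderType d) (x : 'I_n -> T) :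
  injective p -> is_layer L ->
  apply_layer x (relabel_layer p L) \o apply_layer p L
    =1 apply_layer (x \o p) L.
Proof.
move=> pI HL i /=; have HL' := is_layer_relabel pI HL.
case: (channelP L i) => [[c cL E]|H]; last first.
  by rewrite !apply_layer_unused //; apply: relabel_layer_unused.
have cL' : (Order.min (p c.1) (p c.2), Order.max (p c.1) (p c.2))
             \in relabel_layer p L by apply: imset_f.
case: E => ->; rewrite ?apply_layer1 ?apply_layer2 //.
  have /= -> := apply_layer1 HL' x cL'.
  by case: (leP (p c.1)) => // _; rewrite minC.
have /= -> := apply_layer2 HL' x cL'.
by case: (leP (p c.1)) => // _; rewrite maxC.
Qed.

Fixpoint untangle n (p : 'I_n -> 'I_n) (C : network n) : network n :=
  if C is L :: C' then relabel_layer p L :: untangle (apply_layer p L) C'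
  else [::].

Lemma size_untangle n (p : 'I_n -> 'I_n) (C : network n) :
  size (untangle p C) = size C.
Proof. by elim: C p => //= L C IH p; rewrite IH. Qed.

Lemma apply_layer_inj n (p : 'I_n -> 'I_n) (L : layer n) :
  injective p -> is_layer L -> injective (apply_layer p L).
Proof.
move=> pI HL; apply: onto_inj => k.
by rewrite -(f_invF pI k); apply: apply_layer_onto.
Qed.

Lemma comparator_network_untangle n (p : 'I_n -> 'I_n) (C : network n) :
  injective p -> comparator_network C -> comparator_network (untangle p C).
Proof.
elim: C p => //= L C IH p pI /andP[HL HC].
by rewrite is_layer_relabel //; apply: IH => //; apply: apply_layer_inj.
Qed.

Lemma eq_run n d (T : orderType d) (C : network n) (x y : 'I_n -> T) :
  x =1 y -> run C x =1 run C y.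
Proof.
elim: C x y => //= L C IH x y E; apply: IH => i.
by rewrite /apply_layer; case: pickP => [c _|_]; rewrite ?E.
Qed.

Lemma run_untangle n (p : 'I_n -> 'I_n) (C : network n)
    d (T : orderType d) (x : 'I_n -> T) :
  injective p -> comparator_network C ->
  run (untangle p C) x \o run C p =1 run C (x \o p).
Proof.
elim: C p x => //= L C IH p x pI /andP[HL HC] i.
have /= -> := IH _ (apply_layer x (relabel_layer p L))
  (apply_layer_inj pI HL) HC i.
exact/eq_run/apply_relabel_layer.
Qed.

(** It suffices that [run C p] is onto and monotone. Preimages of [i] and [j] in the right order
    reduce the claim to [C] sorting [x \o p]. *)
Lemma sorting_network_untangle n (p : 'I_n -> 'I_n) (C : network n) :
  injective p -> sorting_network C -> sorting_network (untangle p C).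
Proof.
move=> pI [HC sC]; split; first exact: comparator_network_untangle.
move=> d T x i j ij.
have onto k : exists a, run C p a = k.
  by rewrite -(f_invF pI k); apply: run_onto.
have [a Ea] := onto i; have [b Eb] := onto j.
have [ab|/ltnW ba] := leqP a b.
  have R k : run (untangle p C) x (run C p k) = run C (x \o p) k.
    exact: run_untangle.
  by rewrite -Ea -Eb !R; apply: sC.
(* Preimages in the wrong order: [C] also sorts the input [p], which forces [i = j]. *)
have /= := sC _ _ p _ _ ba; rewrite Ea Eb leEord => ji.
by have -> : i = j by apply/val_inj/anti_leq; rewrite ij.
Qed.

(** * The layer [first_layer] and moving a layer into it *)

Lemma mem_first_layer n (c : comparator n) :
  (c \in first_layer n) = ~~ odd c.1 && (c.2 == c.1.+1 :> nat).
Proof.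
rewrite inE; apply/existsP/andP => [[i /andP[/eqP-> /eqP->]]|[ev /eqP E]].
  by rewrite odd_double.
have lt : c.1./2 < n./2 by have := ltn_ord c.2; lia.
exists (Ordinal lt) => /=; rewrite E eqSS andbb.
by rewrite -[X in X == _]odd_double_half (negbTE ev).
Qed.

Lemma is_layer_first_layer n : is_layer (first_layer n).
Proof.
apply/is_layerP; split=> [c|[a b] [a' b'] i]; rewrite !mem_first_layer /uses /=.
  by case/andP=> _ /eqP ->.
move=> /andP[ev /eqP E] /andP[ev' /eqP E'] H H'.
have Ea : a = a' :> nat.
  by case/orP: H => /eqP/(congr1 val)/= H;
    case/orP: H' => /eqP/(congr1 val)/= H'; lia.
by congr pair; apply/val_inj; rewrite //= E E' Ea.
Qed.

(** Counting from 0, an odd channel is paired with its predecessor and an even one with its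
    successor, if that exists. So at most one channel is idle, and the recovery of a prefix from its
    graph rests on this. *)
Lemma first_layer_unused n (i : 'I_n) :
  (forall c, c \in first_layer n -> ~~ uses c i) -> i.+1 = n.
Proof.
move=> H; apply/eqP; rewrite eqn_leq ltn_ord leqNgt; apply/negP => lt.
case: (boolP (odd i)) => oi.
  have lt' : i.-1 < n by have := ltn_ord i; lia.
  have /H/negP[] : (Ordinal lt', i) \in first_layer n.
    by rewrite mem_first_layer /=; move: oi; clear; lia.
  exact: uses2.
have /H/negP[] : (i, Ordinal lt) \in first_layer n.
  by rewrite mem_first_layer /= oi eqxx.
exact: uses1.
Qed.

(** Comparator number [k] of the list occupies positions [2k] and [2k+1], so the position of a
    channel here can serve as its new name. *)
Definition channels n (s : seq (comparator n)) : seq 'I_n :=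
  flatten [seq [:: c.1; c.2] | c <- s].

Lemma mem_channels n (s : seq (comparator n)) i :
  reflect (exists2 c, c \in s & uses c i) (i \in channels s).
Proof.
apply: (iffP flatten_mapP) => -[c cs ci]; exists c => //.
  by move: ci; rewrite !inE.
by rewrite !inE.
Qed.

Lemma uniq_channels n (L : layer n) : is_layer L -> uniq (channels (enum L)).
Proof.
move=> HL; have [H1 H2] := is_layerP _ HL.
have: {subset enum L <= L} by move=> c; rewrite mem_enum.
elim: (enum L) (enum_uniq L) => //= c s IH /andP[cs us] sub.
have cL : c \in L by apply: sub; rewrite inE eqxx.
have nin i : uses c i -> i \notin channels s.
  move=> ci; apply/mem_channels => -[c' c's c'i].
  have c'L : c' \in L by apply: sub; rewrite inE c's orbT.
  by move: cs; rewrite (H2 c c' i cL c'L ci c'i) c's.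
rewrite inE negb_or nin ?uses1 // nin ?uses2 // neq_ltn H1 //=.
by apply: IH => // c' c's; apply: sub; rewrite inE c's orbT.
Qed.

(** The suffix [t] makes room for idle channels; [index] finds the intended occurrence because
    nothing is repeated. *)
Lemma index_channels n (s : seq (comparator n)) t c :
  uniq (channels s ++ t) -> c \in s ->
  ~~ odd (index c.1 (channels s ++ t)) /\
  index c.2 (channels s ++ t) = (index c.1 (channels s ++ t)).+1.
Proof.
elim: s => //= c' s IH /and3P[]; rewrite inE negb_or => /andP[c12 n1] n2 us.
rewrite inE => /predU1P[->|cs]; first by rewrite eqxx (negbTE c12) eqxx.
have [IH1 IH2] := IH us cs.
have nE i j : uses c i -> j \notin channels s ++ t -> (j == i) = false.
  move=> ci; apply: contraNF => /eqP->; rewrite mem_cat.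
  by apply/orP; left; apply/mem_channels; exists c.
rewrite !(nE _ _ (uses1 c)) // !(nE _ _ (uses2 c)) // IH2; split=> //.
by rewrite !oddS negbK.
Qed.

Lemma exists_first_layer_relabel n (L : layer n) : is_layer L ->
  exists2 p : 'I_n -> 'I_n,
    injective p & relabel_layer p L \subset first_layer n.
Proof.
move=> HL.
(* The idle channels come last, so that [s] enumerates all [n] channels; each channel will be sent
   to its position in [s]. *)
pose t := [seq i <- enum 'I_n | i \notin channels (enum L)].
pose s := channels (enum L) ++ t.
have us : uniq s.
  rewrite cat_uniq uniq_channels //= filter_uniq ?enum_uniq // andbT.
  by apply/hasPn => i; rewrite mem_filter => /andP[].
have sT i : i \in s.
  by rewrite mem_cat mem_filter mem_enum andbT; case: (_ \in _).
have ss : size s = n.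
  by rewrite -[RHS]card_ord -(card_uniqP us); apply: eq_card => i; rewrite sT.
have lt i : index i s < n by rewrite -[X in _ < X]ss index_mem.
exists (fun i => Ordinal (lt i)) => [i j /(congr1 val) /= E|].
  by rewrite -(nth_index i (sT i)) E nth_index.
apply/subsetP => _ /imsetP[c cL ->]; rewrite mem_first_layer.
have cs : c \in enum L by rewrite mem_enum.
have [ev E] := index_channels us cs.
have le : (Ordinal (lt c.1) <= Ordinal (lt c.2))%O.
  by rewrite leEord /= -/s E.
by rewrite (min_l le) (max_r le) /= ev -/s E eqxx.
Qed.

(* Comparators of [L'] are idle on the sorted pairs output by [L], so adding
   comparators to the first layer does not harm sorting. *)
Lemma sorting_network_extend_head n (L L' : layer n) (C : network n) :
  L' \subset L -> is_layer L -> sorting_network (L' :: C) ->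
  sorting_network (L :: C).
Proof.
move=> /subsetP sub HL [/= /andP[HL' HC] sC].
split=> [|d T x i j ij]; first by rewrite /= HL.
suff E : apply_layer x L =1 apply_layer (apply_layer x L) L'.
  by rewrite /= !(eq_run C E); apply: (sC _ _ (apply_layer x L)).
move=> k; case: (channelP L' k) => [[c cL' E]|H]; last first.
  by rewrite [RHS]apply_layer_unused.
have cL := sub _ cL'.
have y1 := apply_layer1 HL x cL; have y2 := apply_layer2 HL x cL.
by case: E => ->; rewrite ?(apply_layer1 HL' _ cL') ?(apply_layer2 HL' _ cL') y1 y2;
  case: (leP (x c.1)) => [le|/ltW le]; rewrite ?(min_l le) ?(max_r le).
Qed.

(** * Optimal sorting networks and their depth *)

Lemma is_layer0 n : is_layer (set0 : layer n).
Proof. by apply/is_layerP; split=> [c|c c' i]; rewrite inE. Qed.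

Lemma is_layer_set1 n (c : comparator n) : c.1 < c.2 -> is_layer [set c].
Proof.
move=> lt; apply/is_layerP; split=> [c'|c1 c2 i]; rewrite !inE.
  by move/eqP->.
by move=> /eqP-> /eqP->.
Qed.

(** The invariant of selection sort after [m] rounds: the first [m] channels hold their final
    values. *)
Definition selected n (m : nat) d (T : orderType d) (x : 'I_n -> T) :=
  forall a b : 'I_n, a < m -> a < b -> (x a <= x b)%O.

Lemma run_cat n d (T : orderType d) (C C' : network n) (x : 'I_n -> T) :
  run (C ++ C') x = run C' (run C x).
Proof. exact: foldl_cat. Qed.

(** One round of selection sort: channel [i] is compared in turn with the later channels below [m],
    each comparator forming a layer of its own. Channel [i] collects the minimum and earlier
    channels are untouched. *)
Lemma selection_pass n (i : 'I_n) (m : nat) :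
  exists2 C : network n, comparator_network C &
    forall d (T : orderType d) (x : 'I_n -> T), selected i x ->
      selected i (run C x) /\
      forall b : 'I_n, i < b -> b < m -> (run C x i <= run C x b)%O.
Proof.
elim: m => [|m [C HC sC]]; first by exists [::].
case: (ltnP i m) => [im|mi]; last first.
  exists C => // d T x /sC[s1 s2]; split=> // b ib bm.
  by lia.
case: (ltnP m n) => [mn|nm]; last first.
  exists C => // d T x /sC[s1 s2]; split=> // b ib _.
  by apply: s2 => //; apply: leq_trans nm.
pose c : comparator n := (i, Ordinal mn).
have HL : is_layer [set c] by apply: is_layer_set1.
have cL : c \in [set c] by rewrite inE.
exists (rcons C [set c]) => [|d T x /sC[]].
  by rewrite /comparator_network all_rcons HL.
rewrite -cats1 run_cat /=; set y := run C x => s1 s2.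
have y1 : apply_layer y [set c] i = Order.min (y i) (y (Ordinal mn)).
  exact: (apply_layer1 HL y cL).
have y2 : apply_layer y [set c] (Ordinal mn) = Order.max (y i) (y (Ordinal mn)).
  exact: (apply_layer2 HL y cL).
have y3 k : k != i -> k != Ordinal mn -> apply_layer y [set c] k = y k.
  move=> ki km; apply: apply_layer_unused => _ /set1P->.
  by rewrite /uses negb_or ki.
split=> [a b ai ab|b ib].
  rewrite (y3 a); last 2 first.
  - by rewrite neq_ltn ai.
  - by rewrite neq_ltn (ltn_trans ai im).
  have [->|bi] := eqVneq b i; first by rewrite y1 le_min !s1 //= (ltn_trans ai).
  have [->|bm] := eqVneq b (Ordinal mn).
    by rewrite y2 le_max s1.
  by rewrite y3 // s1.
rewrite ltnS leq_eqVlt => /predU1P[bm|bm].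
  have -> : b = Ordinal mn by apply: val_inj.
  by rewrite y1 y2 ge_min le_max lexx.
rewrite y1 y3 ?neq_ltn ?ib ?orbT //=; last by rewrite bm.
by rewrite ge_min s2.
Qed.

Lemma exists_sorting_network n : exists C : network n, sorting_network C.
Proof.
suff /(_ n (leqnn n)) [C HC sC] : forall m, m <= n ->
    exists2 C : network n, comparator_network C &
      forall d (T : orderType d) (x : 'I_n -> T), selected m (run C x).
  exists C; split=> // d T x i j; rewrite leq_eqVlt => /predU1P[/val_inj->//|].
  exact: sC.
elim=> [|m IH] mn; first by exists [::].
have [C HC sC] := IH (ltnW mn).
have [C' HC' sC'] := selection_pass (Ordinal mn) n.
exists (C ++ C'); first by rewrite /comparator_network all_cat; apply/andP.
move=> d T x a b; rewrite run_cat; have [s1 s2] := sC' _ _ _ (sC _ _ x).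
rewrite ltnS leq_eqVlt => /predU1P[am|am] ab; last exact: s1.
have Ea : a = Ordinal mn by apply: val_inj.
by rewrite Ea; apply: s2 => //; rewrite -[X in X < _]am.
Qed.

(** Descent on the depth. Whether a shorter sorting network exists is decided classically, as
    [sorting_network] quantifies over all ordered types. *)
Lemma exists_optimal_sorting_network n :
  exists C : network n, optimal_depth_sorting_network C.
Proof.
have [C sC] := exists_sorting_network n.
have [m] := ubnP (size C); elim: m C sC => // m IH C sC; rewrite ltnS => Cm.
have [[C' sC' lt]|H] :=
  classic (exists2 C' : network n, sorting_network C' & size C' < size C).
  exact: (IH C' sC' (leq_trans lt Cm)).
exists C; split=> // C' sC'; rewrite leqNgt; apply/negP => lt.
by apply: H; exists C'.
Qed.

(** After one layer an output depends on at most two inputs. With three channels some input [k] is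
    not seen by channel 0, and the Boolean input that is false only at [k] is not sorted. *)
Lemma depth_sorting_network_gt1 n (C : network n) :
  2 < n -> sorting_network C -> 1 < depth C.
Proof.
move=> n2 [HC sC]; rewrite ltnNge; apply/negP => C1.
(* A network of depth 0 acts like a single empty layer. *)
have {HC sC C1} [L HL sL] : exists2 L : layer n, is_layer L &
    forall (x : 'I_n -> bool) (i j : 'I_n),
      i <= j -> (apply_layer x L i <= apply_layer x L j)%O.
  case: C HC sC C1 => [|L [|//]] /= HC sC _; last first.
    by exists L; [rewrite andbT in HC | move=> x; apply: sC].
  exists set0 => [|x i j ij]; first exact: is_layer0.
  by rewrite !apply_layer_unused; [exact: (sC _ _ x)| move=> c; rewrite inE..].
pose i0 : 'I_n := Ordinal (ltn_trans (ltn_trans (ltn0Sn 0) (ltnSn 1)) n2).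
have [k Ek] : exists k : 'I_n,
    forall x : 'I_n -> bool, (forall j, j != k -> x j) -> apply_layer x L i0.
  case: (channelP L i0) => [[c cL Ec]|H]; last first.
    exists (Ordinal n2) => x xk; rewrite apply_layer_unused //.
    exact: xk.
  have [k kc] : exists k, ~~ uses c k.
    apply/existsP; rewrite -negb_forall; apply/negP => /forallP H.
    have : #|'I_n| <= #|[set c.1; c.2]|.
      by apply/subset_leq_card/subsetP => k _; rewrite !inE; apply: H.
    by rewrite card_ord cards2 leqNgt; case: (_ != _); lia.
  exists k => x xk.
  have [x1 x2] : x c.1 /\ x c.2.
    by move: kc; rewrite negb_or => /andP[k1 k2]; rewrite !xk // eq_sym.
  by case: Ec => ->; rewrite ?apply_layer1 ?apply_layer2 // x1 x2.
(* The value false survives on some channel [p], although channel 0 carries true. *)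
have [p Ep] := apply_layer_onto HL (fun j => j != k) k.
have := sL (fun j => j != k) i0 p (leq0n p).
by rewrite Ep Ek // eqxx.
Qed.

(** * Comparators and edges in the graph of a two-layer network *)

Lemma comparator_eq n (c e : comparator n) :
  c.1 < c.2 -> e.1 < e.2 -> uses c =1 uses e -> c = e.
Proof.
case: c e => [a b] [a' b'] /= ab ab' E.
have := E a; have := E b; rewrite /uses /= !eqxx orbT /=.
by move=> /esym/orP[] /eqP Eb /esym/orP[] /eqP Ea; subst; rewrite // ?ltnn in ab *;
   lia.
Qed.

Lemma card_uses n (c : comparator n) :
  c.1 < c.2 -> #|[set i | uses c i]| = 2.
Proof.
move=> lt; have -> : [set i | uses c i] = [set c.1; c.2].
  by apply/setP => i; rewrite !inE.
by rewrite cards2 neq_ltn lt.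
Qed.

(** The cardinality settles membership of the one remaining point. It will be applied with [z] the
    channel idle in the first layer. *)
Lemma eq_set_card_outside1 (T : finType) (A B : {set T}) z :
  #|A| = #|B| -> (forall i, i != z -> (i \in A) = (i \in B)) -> A = B.
Proof.
move=> EC E; apply/setP => i; have [->|/E//] := eqVneq i z.
have ED : A :\ z = B :\ z.
  by apply/setP => j; rewrite !inE; case: eqVneq => //= /E.
by move: EC; rewrite (cardsD1 z A) (cardsD1 z B) ED => /addIn; case: (z \in A);
  case: (z \in B).
Qed.

(** Makes a first-layer vertex together with a label an unambiguous name for a channel, through
    which an isomorphism acts on channels. *)
Lemma out_channel_inj n (L : layer n) l l' c c' : is_layer L ->
  c \in L -> c' \in L -> out_channel l c = out_channel l' c' ->
  c = c' /\ l = l'.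
Proof.
move=> HL cL c'L E; have [H1 H2] := is_layerP _ HL.
have Ec : c = c'.
  apply: (H2 _ _ (out_channel l c)) => //; last rewrite E.
    by case: l {E} => /=; [apply: uses1|apply: uses2].
  by case: l' {E} => /=; [apply: uses1|apply: uses2].
split=> //; subst c'; have := H1 c cL.
by case: l l' E => -[] //= ->; rewrite ltnn.
Qed.

Section TwoLayerGraph.
Variables (n : nat) (A B : layer n).
Notation V := (vertex [:: A; B]).

Definition vertex_layer (v : V) : nat := (val v).1.
Definition vertex_comparator (v : V) : comparator n := (val v).2.

Lemma vertex_layerP (v : V) :
  vertex_layer v = 0 /\ vertex_comparator v \in A \/
  vertex_layer v = 1 /\ vertex_comparator v \in B.
Proof.
by case: v => [[[[|[|]] lt] c] cL]; rewrite /vertex_layer /vertex_comparator;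
  [left|right|].
Qed.

Lemma vertex_comparator0 v : vertex_layer v = 0 -> vertex_comparator v \in A.
Proof. by case: (vertex_layerP v) => -[->]. Qed.

Lemma vertex_comparator1 v : vertex_layer v = 1 -> vertex_comparator v \in B.
Proof. by case: (vertex_layerP v) => -[->]. Qed.

Lemma exists_vertex0 c : c \in A ->
  exists2 v, vertex_layer v = 0 & vertex_comparator v = c.
Proof.
by move=> cA; exists (exist _ (Ordinal (isT : 0 < size [:: A; B]), c) cA).
Qed.

Lemma exists_vertex1 c : c \in B ->
  exists2 v, vertex_layer v = 1 & vertex_comparator v = c.
Proof.
by move=> cB; exists (exist _ (Ordinal (isT : 1 < size [:: A; B]), c) cB).
Qed.

Lemma vertex_eq u v : vertex_layer u = vertex_layer v ->
  vertex_comparator u = vertex_comparator v -> u = v.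
Proof.
move=> El Ec; apply: val_inj; apply: injective_projections => //.
exact: val_inj.
Qed.

(** No layer lies strictly between the two, so the last condition of [edge] is vacuous. *)
Lemma edge_two_layers l (u v : V) :
  edge l u v <->
  [/\ vertex_layer u = 0, vertex_layer v = 1
    & uses (vertex_comparator v) (out_channel l (vertex_comparator u))].
Proof.
have [lu lv] : vertex_layer u < 2 /\ vertex_layer v < 2.
  by split; apply: ltn_ord.
move: lu lv; rewrite /edge /vertex_layer /vertex_comparator.
case: (val u) (val v) => [k c] [k' c'] /= k2 k2'; split=> [[kk' cc _]|[E E' cc]].
  by split=> //; lia.
by split=> // [|m]; lia.
Qed.

End TwoLayerGraph.

(** A second-layer comparator has two channels, at most one of which is idle in the first layer; the
    other yields an incoming edge. *)
Lemma vertex_layer1P n (L : layer n) (v : vertex [:: first_layer n; L]) :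
  is_layer L ->
  vertex_layer v = 1 <-> exists l u, edge l u v.
Proof.
move=> HL; split=> [v1|[l [u /edge_two_layers[]//]]].
have cL := vertex_comparator1 v1; set c := vertex_comparator v in cL.
suff [[e eF [ce|ce]]|H] :
    (exists2 e, e \in first_layer n &
       uses c e.1 \/ uses c e.2) \/
    (forall i, uses c i -> forall e, e \in first_layer n -> ~~ uses e i).
- have [u u0 Eu] := exists_vertex0 L eF.
  by exists Label1, u; apply/edge_two_layers; rewrite /= Eu.
- have [u u0 Eu] := exists_vertex0 L eF.
  by exists Label2, u; apply/edge_two_layers; rewrite /= Eu.
(* Both channels would be the last one, contradicting [c.1 < c.2]. *)
- have E1 := first_layer_unused (H _ (uses1 c)).
  have E2 := first_layer_unused (H _ (uses2 c)).
  have [H1 _] := is_layerP _ HL.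
  by have := H1 _ cL; rewrite -ltnS E1 -{1}E2 ltnn.
case: (channelP (first_layer n) c.1) => [[e eF E]|H1].
  by left; exists e => //; case: E => <-; [left|right]; apply: uses1.
case: (channelP (first_layer n) c.2) => [[e eF E]|H2].
  by left; exists e => //; case: E => <-; [left|right]; apply: uses2.
by right=> i /orP[] /eqP->.
Qed.

(** * The channel permutation induced by a graph isomorphism *)

Section Isomorphism.
Variables (n : nat) (L M : layer n).
Hypotheses (HL : is_layer L) (HM : is_layer M).
Notation F := (first_layer n).
Variable f : vertex [:: F; L] -> vertex [:: F; M].
Hypotheses (f_bij : bijective f)
  (fE : forall l u v, edge l u v <-> edge l (f u) (f v)).

Let HF : is_layer F := is_layer_first_layer n.

Lemma iso_layer v : vertex_layer (f v) = vertex_layer v.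
Proof.
have [g fK gK] := f_bij.
have E : vertex_layer (f v) = 1 <-> vertex_layer v = 1.
  rewrite !vertex_layer1P //; split=> -[l [u luv]]; exists l.
    by exists (g u); apply/fE; rewrite gK.
  by exists (f u); apply/fE.
by case: (vertex_layerP v) (vertex_layerP (f v)) E => [] [-> _] [] [-> _] // [H1 H2];
  [have := H1 erefl|have := H2 erefl].
Qed.

(** Well defined because a channel determines its first-layer comparator and label. A channel idle
    in the first layer has no such name and is fixed. *)
Lemma iso_channel_map : exists p : 'I_n -> 'I_n,
  (forall l u, vertex_layer u = 0 ->
     p (out_channel l (vertex_comparator u)) =
     out_channel l (vertex_comparator (f u))) /\
  (forall i, (forall c, c \in F -> ~~ uses c i) -> p i = i).
Proof.
pose Q (i j : 'I_n) :=
  (forall l u, vertex_layer u = 0 -> out_channel l (vertex_comparator u) = i ->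
     j = out_channel l (vertex_comparator (f u))) /\
  ((forall c, c \in F -> ~~ uses c i) -> j = i).
have: forall i, exists j, Q i j.
  move=> i; case: (channelP F i) => [[c cF E]|H].
    have [u u0 Eu] := exists_vertex0 L cF.
    have [l El] : exists l, out_channel l c = i.
      by case: E => ->; [exists Label1|exists Label2].
    exists (out_channel l (vertex_comparator (f u))); split=> [l' u' u'0 E'|H].
      have cF' := vertex_comparator0 u'0.
      have [Ec ->] := out_channel_inj HF cF cF' (etrans El (esym E')).
      by rewrite (vertex_eq _ (etrans Eu Ec)) // u0.
    by have := H c cF; rewrite -El; case: l {El}; rewrite ?uses1 ?uses2.
  exists i; split=> // l u u0 E; have := H _ (vertex_comparator0 u0).
  by rewrite -E; case: l {E}; rewrite ?uses1 ?uses2.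
case/fin_all_exists => p Hp; exists p; split=> [l u u0|i].
  by have [Hi _] := Hp (out_channel l (vertex_comparator u)); apply: Hi.
by have [_] := Hp i.
Qed.

Lemma out_channelP (i : 'I_n) :
  (exists2 u : vertex [:: F; L], vertex_layer u = 0 &
     exists l, out_channel l (vertex_comparator u) = i) \/
  (forall c, c \in F -> ~~ uses c i).
Proof.
case: (channelP F i) => [[c cF E]|H]; last by right.
have [u u0 Eu] := exists_vertex0 L cF; left; exists u => //; rewrite Eu.
by case: E => ->; [exists Label1|exists Label2].
Qed.

Variable p : 'I_n -> 'I_n.
Hypothesis p_used : forall l u, vertex_layer u = 0 ->
  p (out_channel l (vertex_comparator u)) =
  out_channel l (vertex_comparator (f u)).
Hypothesis p_unused :
  forall i, (forall c, c \in F -> ~~ uses c i) -> p i = i.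

Lemma iso_vertex0 u :
  vertex_layer u = 0 -> vertex_comparator (f u) \in F.
Proof. by rewrite -iso_layer; apply: vertex_comparator0. Qed.

Lemma out_channel_used l (c : comparator n) i :
  c \in F -> (forall e, e \in F -> ~~ uses e i) -> out_channel l c = i -> False.
Proof.
move=> cF H E; have := H c cF; rewrite -E.
by case: l {E}; rewrite ?uses1 ?uses2.
Qed.

(** On channels used by the first layer this comes from injectivity of [f]. Their images are again
    used, hence differ from the idle channel, which is fixed. *)
Lemma iso_channel_inj : injective p.
Proof.
move=> i j.
case: (out_channelP i) => [[u u0 [l <-]]|Hi];
  case: (out_channelP j) => [[v v0 [l' <-]]|Hj].
- rewrite !p_used // => E.
  have [Ec ->] := out_channel_inj HF (iso_vertex0 u0) (iso_vertex0 v0) E.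
  congr (out_channel _ (vertex_comparator _)); apply: (bij_inj f_bij).
  by apply: vertex_eq => //; rewrite !iso_layer u0.
- by rewrite p_used // p_unused // => /(out_channel_used (iso_vertex0 u0) Hj).
- rewrite p_unused // p_used // => /esym.
  by move/(out_channel_used (iso_vertex0 v0) Hi).
- by rewrite !p_unused.
Qed.

(** Labels are preserved, so [p] sends minimum channels to minimum channels and reverses no
    first-layer comparator. *)
Lemma iso_relabel_comparator u : vertex_layer u = 0 ->
  let c := vertex_comparator u in
  (Order.min (p c.1) (p c.2), Order.max (p c.1) (p c.2)) =
  vertex_comparator (f u).
Proof.
move=> u0 c; have := p_used Label1 u0; have := p_used Label2 u0.
rewrite /= -/c => -> ->.
have [H1 _] := is_layerP _ HF; have := H1 _ (iso_vertex0 u0).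
case: (vertex_comparator _) => [a b] /= ab.
have ab' : (a <= b)%O by rewrite leEord ltnW.
by rewrite (min_l ab') (max_r ab').
Qed.

Lemma iso_relabel_first_layer : relabel_layer p F = F.
Proof.
have [g fK gK] := f_bij.
apply/eqP; rewrite eqEsubset; apply/andP; split; apply/subsetP => c.
  case/imsetP => e eF ->; have [u u0 <-] := exists_vertex0 L eF.
  by rewrite iso_relabel_comparator // iso_vertex0.
move=> cF; have [v v0 <-] := exists_vertex0 M cF.
have u0 : vertex_layer (g v) = 0 by rewrite -iso_layer gK.
rewrite -(gK v) -iso_relabel_comparator //.
by apply: imset_f; apply: vertex_comparator0.
Qed.

(** As no first-layer comparator is reversed, untangling hands [p] on unchanged to the second
    layer. *)
Lemma iso_apply_first_layer : apply_layer p F =1 p.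
Proof.
move=> i; case: (channelP F i) => [[c cF E]|]; last exact: apply_layer_unused.
have [u u0 Eu] := exists_vertex0 L cF.
have := p_used Label1 u0; have := p_used Label2 u0.
have := iso_relabel_comparator u0; rewrite /= Eu.
case: (vertex_comparator _) => a b [E1 E2] p2 p1.
by case: E => ->; rewrite ?apply_layer1 ?apply_layer2 // ?E1 ?E2 ?p1 ?p2.
Qed.

(* At most one channel is idle in the first layer, so the number of channels of
   a comparator tells whether it uses that channel, which no edge records. *)
Lemma iso_uses v i : vertex_layer v = 1 ->
  uses (vertex_comparator (f v)) (p i) = uses (vertex_comparator v) i.
Proof.
move=> v1; have fv1 : vertex_layer (f v) = 1 by rewrite iso_layer.
have [H1 _] := is_layerP _ HL; have [H1' _] := is_layerP _ HM.
have used l (u : vertex [:: F; L]) : vertex_layer u = 0 ->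
    uses (vertex_comparator (f v)) (p (out_channel l (vertex_comparator u))) =
    uses (vertex_comparator v) (out_channel l (vertex_comparator u)).
  move=> u0; have fu0 : vertex_layer (f u) = 0 by rewrite iso_layer.
  rewrite p_used //; have [E1 E2] := fE l u v; apply/idP/idP => H.
    by have /edge_two_layers[] : edge l u v by apply/E2/edge_two_layers.
  by have /edge_two_layers[] : edge l (f u) (f v) by apply/E1/edge_two_layers.
case: (out_channelP i) => [[u u0 [l <-]]|Hi]; first exact: used.
suff /setP/(_ i) : [set j | uses (vertex_comparator (f v)) (p j)] =
                   [set j | uses (vertex_comparator v) j] by rewrite !inE.
apply: (eq_set_card_outside1 (z := i)) => [|j ji]; last first.
  rewrite !inE; case: (out_channelP j) => [[u u0 [l <-]]|Hj]; first exact: used.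
  case/eqP: ji; apply: val_inj; apply: succn_inj.
  by rewrite (first_layer_unused Hi) (first_layer_unused Hj).
rewrite (card_uses (H1 _ (vertex_comparator1 v1))).
rewrite -(card_uses (H1' _ (vertex_comparator1 fv1))).
have pB := onW_bij [in [set j | uses (vertex_comparator (f v)) j]]
  (injF_bij iso_channel_inj).
by rewrite -(on_card_preimset pB); apply: eq_card => j; rewrite !inE.
Qed.

(** A comparator is determined by the channels it uses, so [iso_uses] identifies each relabelled
    comparator; surjectivity of [f] gives all of [M]. *)
Lemma iso_relabel_second_layer : relabel_layer p L = M.
Proof.
have [g fK gK] := f_bij; have pI := iso_channel_inj.
have HpL := is_layer_relabel pI HL.
have [H1 _] := is_layerP _ HM; have [H1' _] := is_layerP _ HpL.
have E v : vertex_layer v = 1 -> let c := vertex_comparator v in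
    (Order.min (p c.1) (p c.2), Order.max (p c.1) (p c.2)) =
    vertex_comparator (f v).
  move=> v1 c; have cL : c \in L by apply: vertex_comparator1.
  apply: comparator_eq => [||j]; first by apply/H1'/imset_f.
    by apply/H1/vertex_comparator1; rewrite iso_layer.
  by rewrite -(f_invF pI j) relabel_layer_uses !(inj_eq pI) iso_uses.
apply/eqP; rewrite eqEsubset; apply/andP; split; apply/subsetP => c.
  case/imsetP => e eL ->; have [v v1 <-] := exists_vertex1 F eL.
  by rewrite E // vertex_comparator1 // iso_layer.
move=> cM; have [v v1 <-] := exists_vertex1 F cM.
have u1 : vertex_layer (g v) = 1 by rewrite -iso_layer gK.
by rewrite -(gK v) -E //; apply/imset_f/vertex_comparator1.
Qed.

End Isomorphism.

(** * Replacing the prefix by its representative *)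

(** Untangling proceeds from the left, so the prefix is transformed in the same way whatever tail
    [C] follows; the tail only inherits the accumulated permutation. *)
Lemma graph_equiv_relabel n (L M : layer n) : is_layer L -> is_layer M ->
  graph_equiv [:: first_layer n; L] [:: first_layer n; M] ->
  exists2 p : 'I_n -> 'I_n, injective p &
    forall C, untangle p [:: first_layer n, L & C] =
              [:: first_layer n, M
                & untangle (apply_layer (apply_layer p (first_layer n)) L) C].
Proof.
move=> HL HM [f [fB fE]]; have [p [pu pn]] := iso_channel_map f.
exists p => [|C /=]; first exact: (iso_channel_inj HL HM fB fE pu pn).
rewrite (iso_relabel_first_layer HL HM fB fE pu).
congr [:: _, _ & _].
rewrite -[RHS](iso_relabel_second_layer HL HM fB fE pu pn).
by apply: eq_imset => c; rewrite !(iso_apply_first_layer HL HM fB fE pu).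
Qed.

Theorem theorem1 (n : nat) (R : network n -> Prop)
    (hn : 3 <= n)
    (hR : forall C, R C -> two_layer_network_from (first_layer n) C)
    (hrep : forall C, two_layer_network_from (first_layer n) C ->
      exists! D, R D /\ graph_equiv C D) :
  complete_set_of_filters R.
Proof.
have [C [sC minC]] := exists_optimal_sorting_network n.
have := depth_sorting_network_gt1 hn sC.
case: C sC minC => [|L1 [|L2 C]] // sC minC _.
have [p pI pL1] : exists2 p : 'I_n -> 'I_n,
    injective p & relabel_layer p L1 \subset first_layer n.
  by apply: exists_first_layer_relabel; case: sC => /andP[].
have := sorting_network_untangle pI sC => /=.
move/(sorting_network_extend_head pL1 (is_layer_first_layer n)).
set M2 := relabel_layer _ L2; set C1 := untangle _ C => sC1.
have HM2 : is_layer M2 by case: sC1 => /and3P[].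
have [D [[RD eqD] _]] : exists! D, R D /\ graph_equiv [:: first_layer n; M2] D.
  apply: hrep; split=> //.
  by rewrite /comparator_network /= HM2 is_layer_first_layer.
have [HD] := hR _ RD.
case: D RD eqD HD => [|F' [|M [|//]]] // RD eqD HD _; rewrite /layer_at /= => E.
subst F'.
have HM : is_layer M by case/and3P: HD.
have [q qI Eq] := graph_equiv_relabel HM2 HM eqD.
have := sorting_network_untangle qI sC1; rewrite Eq.
set C2 := untangle _ C1 => sC2.
(* Neither untangling nor enlarging the first layer changes the depth, so minimality carries
   over. *)
exists [:: first_layer n; M], C2; split=> //; split=> // C' /minC.
by rewrite /depth /= !size_untangle.
Qed.
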